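(* Let $G$ be a graph with $n$ vertices. Then for every $k\in\{1,2,\ldots,n\}$, the mapping $f_G:[0,1]\to\mathbb{R}$ defined by $f_G(\alpha)=\lambda_k(B_\alpha(G))$ is uniformly continuous.
   Context: All graphs are simple and undirected, with a finite vertex set. $A(G)$ is the adjacency matrix, $D(G)$ the diagonal matrix of vertex degrees, and $L(G)=D(G)-A(G)$ the Laplacian matrix of $G$. For $\alpha\in[0,1]$, $B_\alpha(G):=\alpha A(G)+(1-\alpha)L(G)$. The eigenvalues of a real symmetric $n\times n$ matrix $S$ are ordered $\lambda_1(S)\ge\lambda_2(S)\ge\cdots\ge\lambda_n(S)$ (with multiplicity). *)

(* Defs.v *)
From HB Require Import structures.
From mathcomp Require Import all_boot all_order all_algebra.
From mathcomp Require Import polyrcf.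
From mathcomp Require Import all_classical all_reals.
From mathcomp Require Import topology normedtype.

Set Implicit Arguments.
Unset Strict Implicit.
Unset Printing Implicit Defensive.

Import Order.TTheory GRing.Theory Num.Theory.
Import numFieldNormedType.Exports.

Local Open Scope ring_scope.

Record sgraph := SGraph {
  vertex :> finType;
  edge : rel vertex;
  edge_sym : symmetric edge;
  edge_irrefl : irreflexive edge
}.

Section GraphMatrices.
Variables (R : realType) (G : sgraph).

Definition degree (x : G) : nat := #|[set y | edge x y]|.

(* Matrices of G are indexed by 'I_#|G|; enum_val lists the vertices. *)
Definition adjacency_mx : 'M[R]_#|G| :=
  \matrix_(i, j) (edge (enum_val i) (enum_val j))%:R.

Definition degree_mx : 'M[R]_#|G| :=
  diag_mx (\row_i (degree (enum_val i))%:R).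

Definition laplacian_mx : 'M[R]_#|G| := degree_mx - adjacency_mx.

Definition B_mx (alpha : R) : 'M[R]_#|G| :=
  alpha *: adjacency_mx + (1 - alpha) *: laplacian_mx.

End GraphMatrices.

(* The real eigenvalues of S in nonincreasing order, each repeated according
   to its multiplicity as a root of the characteristic polynomial; rootsR
   lists every real root once.  For S symmetric this list has n elements. *)
Definition eigenvalues (R : realType) (n : nat) (S : 'M[R]_n) : seq R :=
  sort (fun x y => y <= x)
    (flatten [seq nseq (mup x (char_poly S)) x | x <- rootsR (char_poly S)]).

(* k is counted from 1; the default value 0 is only reached when k exceeds
   the number of real eigenvalues. *)
Definition lambda (R : realType) (n : nat) (k : nat) (S : 'M[R]_n) : R :=
  nth 0 (eigenvalues S) k.-1.

(* Main.v *)
Require Import Defs.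
From mathcomp Require Import all_boot all_order all_algebra.
From mathcomp Require Import spectral sesquilinear polyrcf complex ring.
From mathcomp Require Import all_classical all_reals.
From mathcomp Require Import topology normedtype.

Import Order.TTheory GRing.Theory Num.Theory.
Import numFieldNormedType.Exports.

Local Open Scope classical_set_scope.
Local Open Scope ring_scope.

(** The map alpha |-> lambda_k(B_alpha) is Lipschitz, hence uniformly
    continuous.  Indeed B_alpha - B_beta = (alpha - beta)(A - L) is a multiple
    of a fixed symmetric matrix, whose quadratic form is bounded in absolute
    value by K |x|^2 for some constant K, and Weyl's inequality says that an
    eigenvalue of a symmetric matrix moves by at most c when the quadratic
    form of the matrix moves by at most c |x|^2 ([lambda_le_add]).

    Weyl's inequality is proved by counting dimensions.  Suppose that
    lambda_k(S) > lambda_k(T) + c although x S x* <= x T x* + c |x|^2 for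
    every x.  The eigenvectors of S for eigenvalues >= lambda_k(S) span a space
    of dimension at least k, those of T for eigenvalues <= lambda_k(T) one of
    dimension at least n - k + 1, so some nonzero x lies in both
    ([common_span_vector]); for it
    lambda_k(S) |x|^2 <= x S x* <= x T x* + c |x|^2
                      <= (lambda_k(T) + c) |x|^2,
    a contradiction ([spectral_count_le]).

    Orthonormal eigenbases come from the spectral theorem for normal matrices
    over an algebraically closed field, so real matrices are read over R[i]
    and the vectors x above are complex.  The diagonal that it yields is real
    and lists the roots of the characteristic polynomial with multiplicity;
    this identifies it, up to order, with the list of eigenvalues
    ([symmetric_spectral], [eigenvalues_prod]). *)

(** * Hermitian forms of unitarily diagonalized matrices *)

Section HermitianForms.
Set Implicit Arguments. Unset Strict Implicit.
Local Open Scope sesquilinear_scope.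
Context {C : numClosedFieldType} {n : nat}.
Implicit Types (M P Q : 'M[C]_n) (d e x : 'rV[C]_n) (I J : {set 'I_n}).

Definition qform M x : C := (x *m M *m x^t*) 0 0.

Lemma qformD M1 M2 x : qform (M1 + M2) x = qform M1 x + qform M2 x.
Proof. by rewrite /qform mulmxDr mulmxDl mxE. Qed.

Lemma qformZ a M x : qform (a *: M) x = a * qform M x.
Proof. by rewrite /qform -scalemxAr -scalemxAl mxE. Qed.

(** In the coordinates of x along the rows of P the form is a weighted sum of
    squares; every estimate on forms below is read off from this sum. *)
Lemma qform_diag P d x :
  qform (P^t* *m diag_mx d *m P) x
  = \sum_i d 0 i * `|(x *m P^t*) 0 i| ^+ 2.
Proof.
have -> : qform (P^t* *m diag_mx d *m P) x
    = ((x *m P^t*) *m diag_mx d *m (x *m P^t*)^t*) 0 0.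
  by rewrite /qform trmx_mul map_mxM trmxCK !mulmxA.
move: (x *m P^t*) => y; rewrite mxE; apply: eq_bigr => i _.
by rewrite mul_mx_diag !mxE normCK [_ * d 0 i]mulrC mulrA.
Qed.

Lemma qform1 P x : P \is unitarymx ->
  qform 1%:M x = \sum_i `|(x *m P^t*) 0 i| ^+ 2.
Proof.
move=> Pu; have := qform_diag P (const_mx 1) x.
rewrite diag_const_mx mulmx1 -invmx_unitary// mulVmx ?unitarymx_unit// => ->.
by apply: eq_bigr => i _; rewrite mxE mul1r.
Qed.

Lemma qform1_gt0 x : x != 0 -> 0 < qform 1%:M x.
Proof. by rewrite /qform mulmx1 -dotmxE dnorm_gt0. Qed.

Lemma qform_le P d c x : P \is unitarymx -> (forall i, d 0 i <= c) ->
  qform (P^t* *m diag_mx d *m P) x <= c * qform 1%:M x.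
Proof.
move=> Pu dc; rewrite qform_diag (qform1 x Pu) mulr_sumr.
by apply: ler_sum => i _; rewrite ler_wpM2r ?exprn_ge0.
Qed.

(** Any set of rows of a unitary matrix is orthonormal, hence free: this is
    what gives the two spans below their dimensions. *)
Lemma unitary_rowsub (m : nat) (f : 'I_m -> 'I_n) P :
  injective f -> P \is unitarymx -> rowsub f P \is unitarymx.
Proof.
move=> f_inj /row_unitarymxP Pu; apply/row_unitarymxP => i j.
by rewrite !row_rowsub Pu (inj_eq f_inj).
Qed.

(** For P unitary, the entries of x *m P^t* are the coordinates of x in the
    basis formed by the rows of P. *)
Lemma coord_row_span P I x : P \is unitarymx ->
  (x <= rowsub (enum_val : 'I_#|I| -> 'I_n) P)%MS ->
  forall i, i \notin I -> (x *m P^t*) 0 i = 0.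
Proof.
move=> Pu /submxP[a ->] i iI.
rewrite -mulmxA mul_rowsub_mx (unitarymxP Pu) mxE big1// => j _.
rewrite !mxE; case: eqP => [ji|]; last by rewrite mulr0.
by move: iI; rewrite -ji enum_valP.
Qed.

(** The rows of P in I and the rows of Q in J span spaces of dimensions #|I|
    and #|J|, and two such spaces in dimension n < #|I| + #|J| meet
    nontrivially. *)
Lemma common_span_vector P Q I J : P \is unitarymx -> Q \is unitarymx ->
  (n < #|I| + #|J|)%N ->
  exists x, [/\ x != 0, forall i, i \notin I -> (x *m P^t*) 0 i = 0
                      & forall j, j \notin J -> (x *m Q^t*) 0 j = 0].
Proof.
move=> Pu Qu IJ.
pose A := rowsub (enum_val : 'I_#|I| -> 'I_n) P.
pose B := rowsub (enum_val : 'I_#|J| -> 'I_n) Q.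
have rA : \rank A = #|I|.
  by rewrite mxrank_unitary// unitary_rowsub//; exact: enum_val_inj.
have rB : \rank B = #|J|.
  by rewrite mxrank_unitary// unitary_rowsub//; exact: enum_val_inj.
have cap0 : (A :&: B)%MS != 0.
  rewrite -mxrank_eq0 -lt0n.
  have := mxrank_sum_cap A B; rewrite rA rB => eqr.
  by rewrite -(ltn_add2l (\rank (A + B)%MS)) eqr addn0 (leq_ltn_trans _ IJ)//
    rank_leq_col.
have /rowV0Pn[x + x0] := cap0; rewrite sub_capmx => /andP[xA xB].
by exists x; split=> //; exact: coord_row_span.
Qed.

(** The core of Weyl's inequality: on a nonzero vector of both spans the first
    form is at least s |x|^2 and the second at most t |x|^2, which is
    incompatible with t + c < s.  So the spans meet only in 0. *)
Lemma spectral_count_le P Q d e c s t I J :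
  P \is unitarymx -> Q \is unitarymx ->
  (forall x, qform (P^t* *m diag_mx d *m P) x
             <= qform (Q^t* *m diag_mx e *m Q) x + c * qform 1%:M x) ->
  (forall i, i \in I -> s <= d 0 i) -> (forall j, j \in J -> e 0 j <= t) ->
  t + c < s -> (#|I| + #|J| <= n)%N.
Proof.
move=> Pu Qu ST sd et tcs; rewrite leqNgt; apply/negP => IJ.
have [x [x0 xI xJ]] := common_span_vector Pu Qu IJ.
have lower : s * qform 1%:M x <= qform (P^t* *m diag_mx d *m P) x.
  rewrite (qform1 x Pu) qform_diag mulr_sumr; apply: ler_sum => i _.
  have [/sd sdi|/xI ->] := boolP (i \in I); last by rewrite normr0 expr0n !mulr0.
  by rewrite ler_wpM2r ?exprn_ge0.
have upper : qform (Q^t* *m diag_mx e *m Q) x <= t * qform 1%:M x.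
  rewrite (qform1 x Qu) qform_diag mulr_sumr; apply: ler_sum => j _.
  have [/et etj|/xJ ->] := boolP (j \in J); last by rewrite normr0 expr0n !mulr0.
  by rewrite ler_wpM2r ?exprn_ge0.
have : (t + c) * qform 1%:M x < s * qform 1%:M x.
  by rewrite ltr_pM2r ?qform1_gt0.
rewrite mulrDl => /(le_lt_trans (lerD upper (lexx _))) upper_lt.
by have := lt_le_trans upper_lt (le_trans lower (ST x)); rewrite ltxx.
Qed.
End HermitianForms.

(** * Counting in a nonincreasing list *)

Section SortedList.
Set Implicit Arguments. Unset Strict Implicit.
Context {R : realType}.
Implicit Types (s : seq R).

Lemma nth_nonincreasing s i j : sorted (fun x y => y <= x) s ->
  (i <= j < size s)%N -> nth 0 s j <= nth 0 s i.
Proof.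
move=> ss /andP[ij js].
apply: (sorted_leq_nth _ _ _ ss) => //.
- by move=> y x z yx zy; exact: le_trans zy yx.
- by rewrite inE (leq_ltn_trans ij).
Qed.

Lemma count_ge_nth s k : sorted (fun x y => y <= x) s -> (k < size s)%N ->
  (k < count (fun x => (nth 0 s k <= x)%R) s)%N.
Proof.
move=> ss ks; rewrite -(cat_take_drop k.+1 s) count_cat.
apply: leq_trans (leq_addr _ _).
suff : all (fun x => (nth 0 s k <= x)%R) (take k.+1 s).
  by rewrite cat_take_drop all_count => /eqP ->; rewrite size_takel.
apply/(all_nthP 0) => i; rewrite size_takel// => ik.
by rewrite nth_take// nth_nonincreasing// -ltnS ik.
Qed.

Lemma count_le_nth s k : sorted (fun x y => y <= x) s -> (k < size s)%N ->
  (size s - k <= count (fun x => (x <= nth 0 s k)%R) s)%N.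
Proof.
move=> ss ks; rewrite -[X in count _ X](cat_take_drop k s) count_cat.
apply: leq_trans (leq_addl _ _).
suff : all (fun x => x <= nth 0 s k) (drop k s).
  by rewrite all_count => /eqP ->; rewrite size_drop.
apply/(all_nthP 0) => i; rewrite size_drop => ik.
by rewrite nth_drop nth_nonincreasing// leq_addr -ltn_subRL.
Qed.

End SortedList.

(** * Eigenvalues of real symmetric matrices *)

Lemma char_poly_conj (F : fieldType) (n : nat) (P D : 'M[F]_n) :
  P \in unitmx -> char_poly (invmx P *m D *m P) = char_poly D.
Proof.
move=> Pu; rewrite /char_poly /char_poly_mx.
have -> : 'X%:M - map_mx polyC (invmx P *m D *m P)
    = map_mx polyC (invmx P) *m ('X%:M - map_mx polyC D) *m map_mx polyC P.
  rewrite !map_mxM mulmxBr mulmxBl; congr (_ - _).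
  by rewrite scalar_mxC -mulmxA -map_mxM mulVmx// map_mx1 mulmx1.
by rewrite !det_mulmx mulrAC -det_mulmx -map_mxM mulVmx// map_mx1 det1 mul1r.
Qed.

Section SymmetricEigenvalues.
Set Implicit Arguments. Unset Strict Implicit.
Local Open Scope sesquilinear_scope.
Context {R : realType} {n : nat}.
Implicit Types (S T : 'M[R]_n) (d : 'rV[R]_n).
Local Notation toC := (real_complex R).

(** A list is determined up to order by its multiplicities, and on both sides
    the multiplicity of x is that of x as a root of the characteristic
    polynomial. *)
Lemma eigenvalues_prod S (s : seq R) :
  char_poly S = \prod_(x <- s) ('X - x%:P) -> perm_eq (eigenvalues S) s.
Proof.
move=> Ss; rewrite /eigenvalues perm_sort; apply/allP => x _ /=; apply/eqP.
have p0 : char_poly S != 0 by rewrite monic_neq0// char_poly_monic.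
rewrite -(mu_prod_XsubC x s) -Ss; set p := char_poly S in p0 *.
(* The distinct entries of r contribute disjoint blocks of copies. *)
have countE (r : seq R) : uniq r ->
    count_mem x (flatten [seq nseq (mup y p) y | y <- r])
    = if x \in r then mup x p else 0%N.
  elim: r => //= y r IHr /andP[yr ur]; rewrite count_cat IHr// count_nseq /=.
  rewrite inE eq_sym; have [->|xy] := eqVneq x y; last by rewrite mul0n.
  by rewrite (negbTE yr) mul1n addn0.
rewrite countE ?uniq_roots//.
have := roots_on_rootsR p0 x; rewrite in_itv /= => <-.
by case: ifPn => // /mupNroot ->.
Qed.

(** A real symmetric matrix is hermitian over R[i], so its complex spectral
    diagonal has real entries; the factorization of the characteristic
    polynomial descends to R because the embedding of R in R[i] is
    injective. *)
Lemma symmetric_spectral S : S^T = S ->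
  exists (P : 'M[complex R]_n) (d : 'rV[R]_n),
    [/\ P \is unitarymx,
        map_mx toC S = P^t* *m diag_mx (map_mx toC d) *m P
      & char_poly S = \prod_(i < n) ('X - (d 0 i)%:P)].
Proof.
move=> Ssym; set A := map_mx toC S.
have Aherm : A \is hermsymmx.
  apply: realsym_hermsym.
    by apply/is_hermitianmxP; rewrite expr0 scale1r map_mx_id// map_trmx Ssym.
  by apply/mxOverP => i j; rewrite mxE complex_real.
have dreal := hermitian_spectral_diag_real Aherm.
pose d := map_mx (@complex.Re R) (spectral_diag A).
have dE : map_mx toC d = spectral_diag A.
  by apply/rowP => i; rewrite !mxE RRe_real// (mxOverP dreal).
have /orthomx_spectralP AE := hermitian_normalmx Aherm.
exists (spectralmx A), d; split; first exact: spectral_unitarymx.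
  by rewrite dE -invmx_unitary ?spectral_unitarymx.
apply: (map_poly_inj toC); rewrite map_char_poly -/A rmorph_prod /=.
rewrite AE char_poly_conj ?spectral_unit// char_poly_trig ?diag_mx_is_trig//.
apply: eq_bigr => i _.
by rewrite rmorphB /= map_polyX map_polyC /= -dE !mxE eqxx.
Qed.

Lemma count_ord (a : pred R) d :
  count a [seq d 0 i | i <- enum 'I_n] = #|[set i | a (d 0 i)]%SET|.
Proof.
rewrite -sum1_count -sum1_card big_map big_enum_cond /=.
by apply: eq_bigl => i; rewrite inE.
Qed.

(** Weyl's inequality.  Counted with multiplicity, at least k eigenvalues of S
    are >= lambda_k(S) and at least n - k + 1 eigenvalues of T are
    <= lambda_k(T); their total exceeds n, so [spectral_count_le] forbids a gap larger than c. *)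
Lemma lambda_le_add S T c k : S^T = S -> T^T = T -> (0 < k <= n)%N ->
  (forall x, qform (map_mx toC (S - T)) x <= toC c * qform 1%:M x) ->
  lambda k S <= lambda k T + c.
Proof.
move=> Ssym Tsym /andP[k0 kn] STc.
have [P [d [Pu SE /esym Sd]]] := symmetric_spectral Ssym.
have [Q [e [Qu TE /esym Te]]] := symmetric_spectral Tsym.
have perm_eigen (U : 'M[R]_n) (f : 'rV[R]_n) :
    \prod_(i < n) ('X - (f 0 i)%:P) = char_poly U ->
    perm_eq (eigenvalues U) [seq f 0 i | i <- enum 'I_n].
  by move=> Uf; apply: eigenvalues_prod; rewrite big_map big_enum.
have eS := perm_eigen _ _ Sd; have eT := perm_eigen _ _ Te.
have sizeE (U : 'M[R]_n) (f : 'rV[R]_n) :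
    perm_eq (eigenvalues U) [seq f 0 i | i <- enum 'I_n] ->
    size (eigenvalues U) = n.
  by move=> /perm_size ->; rewrite size_map size_enum_ord.
have sorted_eigen (U : 'M[R]_n) : sorted (fun x y => y <= x) (eigenvalues U).
  by apply: sort_sorted => x y; exact: le_total.
rewrite leNgt; apply/negP => TS.
have k1n : (k.-1 < n)%N by rewrite prednK.
(* lambda_k is item k.-1 of the list of eigenvalues, numbered from 0. *)
have := @count_ge_nth _ _ k.-1 (sorted_eigen S); rewrite (sizeE _ _ eS).
move=> /(_ k1n); rewrite (permP eS) count_ord prednK// => cS.
have := @count_le_nth _ _ k.-1 (sorted_eigen T); rewrite (sizeE _ _ eT).
move=> /(_ k1n); rewrite (permP eT) count_ord => cT.
have := @spectral_count_le _ _ P Q (map_mx toC d) (map_mx toC e)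
  (toC c) (toC (lambda k S)) (toC (lambda k T)) _ _ Pu Qu.
rewrite -SE -TE => /(_ [set i | lambda k S <= d 0 i]%SET
  [set i | e 0 i <= lambda k T]%SET).
have sum_le : (n < #|[set i | (lambda k S <= d 0 i)%R]%SET|
                 + #|[set i | (e 0 i <= lambda k T)%R]%SET|)%N.
  apply: leq_trans (leq_add cS cT).
  by rewrite -{1}(prednK k0) addSn ltnS subnKC// ltnW.
have STx x : qform (map_mx toC S) x
    <= qform (map_mx toC T) x + toC c * qform 1%:M x.
  by rewrite -lerBlDl -[- _]mulN1r -qformZ -qformD scaleN1r -map_mxB.
move=> /(_ STx); rewrite leqNgt sum_le.
move=> no_gap; suff: false by []; apply: no_gap.
- by move=> i; rewrite inE mxE lecR.
- by move=> i; rewrite inE mxE lecR.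
- by rewrite -rmorphD ltcR.
Qed.

(** K only has to dominate every eigenvalue of S in absolute value; their
    total absolute value does, and needs no maximum over a possibly empty
    index set. *)
Lemma symmetric_qform_bound S : S^T = S ->
  exists2 K : R, 0 <= K & forall a x,
    qform (map_mx toC (a *: S)) x <= toC (`|a| * K) * qform 1%:M x.
Proof.
move=> Ssym; have [P [d [Pu SE _]]] := symmetric_spectral Ssym.
exists (\sum_i `|d 0 i|); first exact: sumr_ge0.
move=> a x; rewrite map_mxZ SE.
have -> : toC a *: (P^t* *m diag_mx (map_mx toC d) *m P)
    = P^t* *m diag_mx (map_mx toC (a *: d)) *m P.
  by rewrite map_mxZ linearZ /= -scalemxAr -scalemxAl.
apply: qform_le => // i; rewrite !mxE lecR.
rewrite (le_trans (ler_norm _))// normrM ler_wpM2l//.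
by rewrite (bigD1 i)//= lerDl sumr_ge0.
Qed.

End SymmetricEigenvalues.

(** * The matrices B_alpha *)

Lemma adjacency_mx_sym (R : realType) (G : sgraph) :
  (adjacency_mx R G)^T = adjacency_mx R G.
Proof. by apply/matrixP => i j; rewrite !mxE edge_sym. Qed.

Lemma laplacian_mx_sym (R : realType) (G : sgraph) :
  (laplacian_mx R G)^T = laplacian_mx R G.
Proof.
by rewrite /laplacian_mx linearB /= adjacency_mx_sym tr_diag_mx.
Qed.

Lemma B_mx_sym (R : realType) (G : sgraph) (alpha : R) :
  (B_mx G alpha)^T = B_mx G alpha.
Proof.
by rewrite /B_mx linearD /= !linearZ /= adjacency_mx_sym laplacian_mx_sym.
Qed.

Lemma B_mxB (R : realType) (G : sgraph) (alpha beta : R) :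
  B_mx G alpha - B_mx G beta
  = (alpha - beta) *: (adjacency_mx R G - laplacian_mx R G).
Proof. by apply/matrixP => i j; rewrite !mxE; ring. Qed.

Lemma lambda_B_mx_lipschitz (R : realType) (G : sgraph) (k : nat) :
  (0 < k <= #|G|)%N ->
  exists2 K : R, 0 <= K & forall alpha beta : R,
    `|lambda k (B_mx G alpha) - lambda k (B_mx G beta)| <= K * `|alpha - beta|.
Proof.
move=> hk.
have [|K K0 bound] := @symmetric_qform_bound R _
    (adjacency_mx R G - laplacian_mx R G).
  by rewrite linearB /= adjacency_mx_sym laplacian_mx_sym.
exists K => // alpha beta.
have one_side (a b : R) :
    lambda k (B_mx G a) - lambda k (B_mx G b) <= K * `|a - b|.
  rewrite lerBlDl mulrC; apply: lambda_le_add => //; rewrite ?B_mx_sym// => x.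
  by rewrite B_mxB.
by rewrite ler_norml one_side lerNl opprB distrC one_side.
Qed.

Theorem theorem3p1 (R : realType) (G : sgraph) (k : nat)
    (hk : (1 <= k <= #|G|)%N) :
  unif_continuous
    ((fun alpha : R => lambda k (B_mx G alpha)) : subspace `[0, 1] -> R).
Proof.
have [K K0 lip] := @lambda_B_mx_lipschitz R G k hk.
move=> U; rewrite -entourage_ballE => -[e /= e0 eU].
(* K may be 0, so the radius is e / (K + 1) rather than e / K. *)
exists [set xy : R * R | ball xy.1 (e / (K + 1)) xy.2].
  rewrite -entourage_ballE; exists (e / (K + 1)) => //=.
  by rewrite divr_gt0// ltr_wpDl.
move=> [x y] /= xy; apply: eU => /=.
case: xy => [->|[_ [_ xy]]]; first exact: ballxx.
rewrite -ball_normE /= in xy *.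
apply: le_lt_trans (lip _ _) _.
rewrite ltr_pdivlMr in xy; last by rewrite ltr_wpDl.
by apply: le_lt_trans xy; rewrite mulrC ler_wpM2l// lerDl.
Qed.
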